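(* Let $T\ge 2$ and $n\ge 2$ be integers, both odd, with $2T\le n+1$, and let $V$ be the value of the periodic patrolling game on the line graph $L_n$ with period $T$ and attack duration $2$. Then $$V=\frac{2T-1}{nT}.$$ The uniform attack strategy is optimal for the Attacker, and there is an optimal strategy for the Patroller that is a probabilistic choice (a probability mixture) of biased oscillations.
   Context: The line graph $L_n$ is the graph with node set $\{1,2,\dots,n\}$ and edges $\{i,i+1\}$ for $i=1,\dots,n-1$ (the path on $n$ nodes). The periodic patrolling game on a graph $Q$ with node set $N$, period $T$ and attack duration $2$ is the following finite zero-sum game. Times form the time circle $\{1,2,\dots,T\}$ with arithmetic modulo $T$. A pure strategy of the Patroller (a patrol) is a walk $w:\{1,2,\ldots\}\to N$ such that $w(t)$ and $w(t+1)$ are the same or adjacent nodes and $w(t+T)=w(t)$ for all $t$. A pure strategy of the Attacker is a pair consisting of a node $i\in N$ and a starting time $t$ (modulo $T$), with attack interval $J=\{t,t+1\}$; there are thus $|N|\,T$ possible attacks. The patrol $w$ intercepts the attack if $w(s)=i$ for some $s\in J$; the payoff (to the Patroller, who maximizes; the Attacker minimizes) is $1$ if the attack is intercepted and $0$ otherwise. Both players may use mixed strategies; $V$ is the value of the game (expected payoff under optimal play). The uniform attack strategy is the mixed Attacker strategy choosing equiprobably among all $|N|\,T$ attacks. Biased oscillations ($T=2q+1$ odd): for $p\in[0,1]$ and $i\in\{1,\dots,n-1\}$, a right $p$-biased oscillation $\overrightarrow{b}_p(i)$ is the randomized $T$-periodic walk on the two nodes $i,i+1$ in which the two nodes alternate,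 except that with probability $p$ the right-hand node $i+1$ is repeated at two consecutive times (so the walk is at $i+1$ for $q+1$ periods and at $i$ for $q$ periods), and with probability $1-p$ the left-hand node $i$ is repeated at two consecutive times; in either case the time (modulo $T$) of the repetition is chosen uniformly at random. A left $p$-biased oscillation is $\overleftarrow{b}_p(i)=\overrightarrow{b}_{1-p}(i)$. A biased oscillation is any such left or right $p$-biased oscillation. *)

(* Defs.v *)
From HB Require Import structures.
From mathcomp Require Import all_boot all_order all_algebra.
From mathcomp Require Import all_classical all_reals.
Set Implicit Arguments.
Unset Strict Implicit.
Unset Printing Implicit Defensive.
Import Order.TTheory GRing.Theory Num.Theory.
Local Open Scope classical_set_scope.
Local Open Scope ring_scope.

(** [u a b] is the payoff to the maximizer, who plays [a : A], against the
    minimizer, who plays [b : B]. *)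

Section Game.
Variable R : realType.

Definition mixed (A : finType) : set {ffun A -> R} :=
  [set x | (forall a, 0 <= x a) /\ \sum_a x a = 1].

Variables (A B : finType) (u : A -> B -> R).

Definition payoff (x : {ffun A -> R}) (y : {ffun B -> R}) : R :=
  \sum_a \sum_b x a * y b * u a b.

Definition max_guarantee (x : {ffun A -> R}) : R :=
  inf [set payoff x y | y in @mixed B].

Definition min_guarantee (y : {ffun B -> R}) : R :=
  sup [set payoff x y | x in @mixed A].

Definition maximin : R := sup [set max_guarantee x | x in @mixed A].

Definition minimax : R := inf [set min_guarantee y | y in @mixed B].

Definition is_value (v : R) : Prop := maximin = v /\ minimax = v.

Definition max_optimal (x : {ffun A -> R}) : Prop :=
  mixed x /\ max_guarantee x = maximin.

Definition min_optimal (y : {ffun B -> R}) : Prop :=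
  mixed y /\ min_guarantee y = minimax.

End Game.

(** The time circle is ['I_T], whose cyclic successor is [ordS]; times and the
    nodes of the line graph are therefore numbered from 0. *)

Definition is_patrol (N : finType) (e : rel N) (T : nat)
    (w : {ffun 'I_T -> N}) : bool :=
  [forall t, (w t == w (ordS t)) || e (w t) (w (ordS t))].

Record patrol (N : finType) (e : rel N) (T : nat) := Patrol {
  walk :> {ffun 'I_T -> N};
  _ : is_patrol e walk }.

HB.instance Definition _ (N : finType) (e : rel N) (T : nat) :=
  [isSub for @walk N e T].
HB.instance Definition _ (N : finType) (e : rel N) (T : nat) :=
  [Finite of patrol e T by <:].

(** [(i, t)] is the attack at node [i] during the interval [{t, t + 1}]. *)
Notation attack N T := (N * 'I_T)%type.

Definition intercepts (N : finType) (e : rel N) (T : nat)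
    (w : patrol e T) (a : attack N T) : bool :=
  (w a.2 == a.1) || (w (ordS a.2) == a.1).

Definition patrolling_game (R : realType) (N : finType) (e : rel N) (T : nat)
    (w : patrol e T) (a : attack N T) : R :=
  (intercepts w a)%:R.
Arguments patrolling_game : clear implicits.

Definition uniform_attack (R : realType) (N : finType) (T : nat) :
    {ffun attack N T -> R} :=
  [ffun _ => (#|N| * T)%:R^-1].
Arguments uniform_attack : clear implicits.

Definition line_graph (n : nat) : rel 'I_n :=
  [rel i j : 'I_n | (i.+1 == j :> nat) || (j.+1 == i :> nat)].
Arguments line_graph : clear implicits.

(** For odd [T], the walk alternating between [a] and [b] that stands at [a] at both times
    [s] and [s + 1]: [(t + (T - s.+1)) %% T] is the time elapsed, around the
    circle, from [s + 1] to [t]. *)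
Definition oscillation (N : finType) (T : nat) (a b : N) (s : 'I_T) :
    {ffun 'I_T -> N} :=
  [ffun t : 'I_T => if odd ((t + (T - s.+1)) %% T) then b else a].

(** The law of [oscillation a b s] for [s] uniform on the time circle. *)
Definition random_oscillation (R : realType) (N : finType) (e : rel N)
    (T : nat) (a b : N) (w : patrol e T) : R :=
  #|[set s : 'I_T | walk w == oscillation a b s]%SET|%:R / T%:R.

(** A randomized walk is represented by its law on patrols. In the next two
    definitions [i] is the left-hand node and [j] the right-hand one. *)
Definition right_biased (R : realType) (n T : nat) (p : R) (i j : 'I_n) :
    {ffun patrol (line_graph n) T -> R} :=
  [ffun w => p * random_oscillation R j i w
             + (1 - p) * random_oscillation R i j w].
Arguments right_biased : clear implicits.

Definition left_biased (R : realType) (n T : nat) (p : R) (i j : 'I_n) :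
    {ffun patrol (line_graph n) T -> R} :=
  right_biased R n T (1 - p) i j.
Arguments left_biased : clear implicits.

Definition biased_oscillation (R : realType) (n T : nat)
    (x : {ffun patrol (line_graph n) T -> R}) : Prop :=
  exists (p : R) (i j : 'I_n),
    [/\ 0 <= p <= 1, j = i.+1 :> nat &
        x = right_biased R n T p i j \/ x = left_biased R n T p i j].

Definition mixture_of (R : realType) (A : finType)
    (P : {ffun A -> R} -> Prop) (x : {ffun A -> R}) : Prop :=
  exists (m : nat) (l : {ffun 'I_m -> R}) (b : 'I_m -> {ffun A -> R}),
    [/\ mixed l, forall k, P (b k) &
        forall a, x a = \sum_(k < m) l k * b k a].

(* Main.v *)
(** A patrol intercepts two of the attacks starting at time [t], or one if it
    does not move between [t] and [t + 1]. The line graph is bipartite and [T]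
    is odd, so every patrol pauses at least once and intercepts at most
    [2 T - 1] of the [n T] attacks: the uniform attack gives the upper bound.

    A biased oscillation on an edge intercepts attacks at its two ends with
    probabilities that add up to [(2 T - 1) / T] and whose ratio can be any
    number between [(T - 1) / T] and [T / (T - 1)]. The Patroller equalizes the
    nodes by letting the edge [{e, e + 1}] contribute the fractions [cover e]
    and [1 - cover (e + 1)] of the value at its left and right ends, where
    [cover] runs through
    [1, 1/T, (T-2)/(T-1), 2/T, (T-3)/(T-1), 3/T, ..., 1/(T-1), (T-1)/T, 0, 1, 0, 1, ..., 0];
    it can stop at node [n - 1] because [n - 1] is even and at least [2 T - 2]. *)

Require Import Defs.
From mathcomp Require Import all_boot all_order all_algebra.
From mathcomp Require Import all_classical all_reals.
From mathcomp Require Import zify ring lra.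
Set Implicit Arguments.
Unset Strict Implicit.
Unset Printing Implicit Defensive.
Import Order.TTheory GRing.Theory Num.Theory.
Local Open Scope ring_scope.

(** * Saddle points of finite zero-sum games *)

Section SaddlePoint.
Variables (R : realType) (A B : finType) (u : A -> B -> R).

Lemma payoffEl (x : {ffun A -> R}) (y : {ffun B -> R}) :
  payoff u x y = \sum_a x a * \sum_b y b * u a b.
Proof.
rewrite /payoff; apply: eq_bigr => a _.
by rewrite mulr_sumr; apply: eq_bigr => b _; rewrite mulrA.
Qed.

Lemma payoffEr (x : {ffun A -> R}) (y : {ffun B -> R}) :
  payoff u x y = \sum_b y b * \sum_a x a * u a b.
Proof.
rewrite /payoff exchange_big; apply: eq_bigr => b _.
by rewrite mulr_sumr; apply: eq_bigr => a _; rewrite mulrCA mulrA.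
Qed.

Lemma mixed_le1 (C : finType) (x : {ffun C -> R}) c :
  mixed x -> 0 <= x c <= 1.
Proof.
move=> [x0 x1]; rewrite x0 -x1 (bigD1 c) //= lerDl.
by apply: sumr_ge0 => *; exact: x0.
Qed.

(** A crude bound, uniform in the strategies, so that every [inf] and [sup] over payoffs is taken
    over a bounded set. *)
Lemma payoff_norm_le (x : {ffun A -> R}) (y : {ffun B -> R}) :
  mixed x -> mixed y -> `|payoff u x y| <= \sum_a \sum_b `|u a b|.
Proof.
move=> mx my; apply: le_trans (ler_norm_sum _ _ _) _; apply: ler_sum => a _.
apply: le_trans (ler_norm_sum _ _ _) _; apply: ler_sum => b _.
have /andP[x0 x1] := mixed_le1 a mx; have /andP[y0 y1] := mixed_le1 b my.
by rewrite normrM ler_piMl // ger0_norm ?mulr_ge0 // mulr_ile1.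
Qed.

(** The payoff is linear in each strategy, so bounds against pure replies extend to mixed ones; the
    two guarantees then squeeze [maximin] and [minimax] onto [v]. *)
Lemma saddle_point (x0 : {ffun A -> R}) (y0 : {ffun B -> R}) (v : R) :
    mixed x0 -> mixed y0 ->
    (forall b, v <= \sum_a x0 a * u a b) ->
    (forall a, \sum_b y0 b * u a b <= v) ->
  [/\ is_value u v, max_optimal u x0 & min_optimal u y0].
Proof.
move=> mx0 my0 hx hy.
have ge_v y : mixed y -> v <= payoff u x0 y.
  move=> [y_ge0 y1]; rewrite payoffEr -[v]mul1r -y1 mulr_suml.
  by apply: ler_sum => b _; rewrite ler_wpM2l.
have le_v x : mixed x -> payoff u x y0 <= v.
  move=> [x_ge0 x1]; rewrite payoffEl -[leRHS]mul1r -x1 mulr_suml.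
  by apply: ler_sum => a _; rewrite ler_wpM2l.
have max_le x : mixed x -> max_guarantee u x <= v.
  move=> mx; apply: le_trans (le_v _ mx); apply: ge_inf; last by exists y0.
  exists (- \sum_a \sum_b `|u a b|) => _ [y my <-].
  by have := payoff_norm_le mx my; rewrite ler_norml => /andP[].
have min_ge y : mixed y -> v <= min_guarantee u y.
  move=> my; apply: le_trans (ge_v _ my) _; apply: ub_le_sup; last by exists x0.
  exists (\sum_a \sum_b `|u a b|) => _ [x mx <-].
  by have := payoff_norm_le mx my; rewrite ler_norml => /andP[].
have max_x0 : max_guarantee u x0 = v.
  apply/eqP; rewrite eq_le max_le //=; apply: lb_le_inf.
    by exists (payoff u x0 y0); exists y0.
  by move=> _ [y my <-]; exact: ge_v.
have min_y0 : min_guarantee u y0 = v.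
  apply/eqP; rewrite eq_le min_ge // andbT; apply: ge_sup.
    by exists (payoff u x0 y0); exists x0.
  by move=> _ [x mx <-]; exact: le_v.
have maxE : maximin u = v.
  apply/eqP; rewrite eq_le; apply/andP; split.
    apply: ge_sup; first by exists (max_guarantee u x0); exists x0.
    by move=> _ [x mx <-]; exact: max_le.
  rewrite -max_x0; apply: ub_le_sup; last by exists x0.
  by exists v => _ [x mx <-]; exact: max_le.
have minE : minimax u = v.
  apply/eqP; rewrite eq_le; apply/andP; split.
    rewrite -min_y0; apply: ge_inf; last by exists y0.
    by exists v => _ [y my <-]; exact: min_ge.
  apply: lb_le_inf; first by exists (min_guarantee u y0); exists y0.
  by move=> _ [y my <-]; exact: min_ge.
by split; split; rewrite ?maxE ?minE.
Qed.

End SaddlePoint.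

(** * Upper bound from the uniform attack *)

Section UniformAttack.
Variables (n T : nat).

Lemma uniform_attack_mixed (R : realType) (hn : (0 < n)%N) (hT : (0 < T)%N) :
  mixed (uniform_attack R 'I_n T).
Proof.
split=> [a|]; first by rewrite ffunE invr_ge0.
under eq_bigr do rewrite ffunE.
rewrite sumr_const card_prod !card_ord -[LHS]mulr_natr mulVf //.
by rewrite pnatr_eq0 -lt0n muln_gt0 hn hT.
Qed.

(** Each move flips the parity of the node, and an odd closed walk cannot flip at every step. *)
Lemma odd_patrol_pauses (w : patrol (line_graph n) T) :
  odd T -> exists t, w t = w (ordS t).
Proof.
move=> oddT; suff /existsP[t /eqP pause] : [exists t, w t == w (ordS t)] by exists t.
apply: contraLR oddT; rewrite negb_exists => /forallP moves.
have flip t : (odd (w t) + odd (w (ordS t)) = 1)%N.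
  have := forallP (valP w) t; rewrite (negPf (moves t)) /=.
  by case/orP => /eqP <- /=; case: odd.
(* Without pauses every summand is 1; yet rotating the time circle shows that the sum counts each
   [odd (w t)] twice, so it is even. *)
have /(congr1 odd) <- : (\sum_t (odd (w t) + odd (w (ordS t))) = T)%N.
  by under eq_bigr do rewrite flip; rewrite sum1_card card_ord.
rewrite big_split /= -(reindex (@ordS T) (P := xpredT)
  (F := fun t => odd (w t) : nat)) /=; last exact: onW_bij (ordS_bij T).
by rewrite addnn odd_double.
Qed.

Lemma intercepted_at_time (w : patrol (line_graph n) T) t :
  (\sum_(i < n) intercepts w (i, t) + (w t == w (ordS t)) = 2)%N.
Proof.
pose S := [set w t; w (ordS t)]%SET.
have -> : (\sum_(i < n) intercepts w (i, t) = #|S|)%N.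
  rewrite -sum1_card [RHS]big_mkcond; apply: eq_bigr => i _.
  by rewrite !inE /intercepts /= (eq_sym i) (eq_sym i); case: (_ || _).
by rewrite cards2; case: (w t == _).
Qed.

(** Two interceptions per starting time, minus one for each pause, of which there is at least
    one. *)
Lemma intercepted_le (w : patrol (line_graph n) T) :
  odd T -> (\sum_a intercepts w a <= 2 * T - 1)%N.
Proof.
move=> oddT; have [t0 pause] := odd_patrol_pauses w oddT.
have : (\sum_(t < T) (\sum_(i < n) intercepts w (i, t)
                      + (w t == w (ordS t))) = T * 2)%N.
  under eq_bigr do rewrite intercepted_at_time.
  by rewrite sum_nat_const card_ord.
rewrite big_split /= exchange_big pair_big /= [X in (_ + X)%N](bigD1 t0) //=.
rewrite pause eqxx (eq_bigr (fun a => intercepts w a : nat)); last by case.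
by lia.
Qed.

Lemma uniform_attack_payoff_le (R : realType) (w : patrol (line_graph n) T) :
    (0 < T)%N -> odd T ->
  \sum_a uniform_attack R 'I_n T a * patrolling_game R 'I_n (line_graph n) T w a
    <= (2 * T%:R - 1) / (n%:R * T%:R).
Proof.
move=> T_gt0 oddT; under eq_bigr do rewrite ffunE.
rewrite -mulr_sumr -natr_sum card_ord mulrC natrM ler_wpM2r //.
  by rewrite invr_ge0 mulr_ge0.
have -> : 2 * T%:R - 1 = (2 * T - 1)%:R :> R by rewrite natrB ?natrM //; lia.
by rewrite ler_nat intercepted_le.
Qed.

End UniformAttack.

(** * Oscillations with a uniformly random pause *)

Section Oscillation.
Variables (T : nat) (oddT : odd T).

(** The time elapsed since [s + 1] grows by one until it wraps from [T - 1] to 0 at [t = s]. As [T]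
    is odd, both of these are even, so the parity flips everywhere else only. *)
Lemma odd_elapsed_ordS (s t : 'I_T) :
  odd ((ordS t + (T - s.+1)) %% T)
    = (t != s) && ~~ odd ((t + (T - s.+1)) %% T).
Proof.
rewrite /= modnDml -addn1 addnAC -modnDml.
have sT := ltn_ord s; have tT := ltn_ord t.
rewrite -(inj_eq val_inj) /=.
have [ts|st] := leqP t s.
  rewrite [((t + _) %% T)%N]modn_small; last by lia.
  have [-> /=|ne /=] := eqVneq (t : nat) s.
    by rewrite (_ : s + _ + 1 = T)%N ?modnn //; lia.
  by rewrite modn_small; lia.
have -> : (t + (T - s.+1) = T + (t - s.+1))%N by lia.
rewrite modnDl [((t - _) %% T)%N]modn_small; last by lia.
by rewrite modn_small; lia.
Qed.

Lemma odd_elapsed_pause (s : 'I_T) : odd ((s + (T - s.+1)) %% T) = false.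
Proof. by have sT := ltn_ord s; rewrite modn_small; lia. Qed.

Variables (N : finType) (e : rel N) (a b : N).

Lemma oscillation_patrol s :
  e a b -> e b a -> is_patrol e (oscillation a b s : {ffun 'I_T -> N}).
Proof.
move=> eab eba; apply/forallP => t; rewrite !ffunE odd_elapsed_ordS.
have [->|_] := eqVneq t s; first by rewrite odd_elapsed_pause eqxx.
by case: odd; rewrite /= ?eab ?eba orbT.
Qed.

(** Two consecutive times show both nodes, except that those starting at the pause [s] show [a]
    alone. *)
Lemma oscillation_visits (s t : 'I_T) c : a != b ->
  (oscillation a b s t == c) || (oscillation a b s (ordS t) == c)
    = (c == a) || (c == b) && (t != s).
Proof.
move=> ab; rewrite !ffunE odd_elapsed_ordS.
have [->|_] := eqVneq t s.
  by rewrite odd_elapsed_pause /= orbb andbF orbF eq_sym.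
by case: odd; rewrite /= ![_ == c]eq_sym andbT // orbC.
Qed.

Lemma sum_random_oscillation (R : realType) (f : {ffun 'I_T -> N} -> R) :
    e a b -> e b a ->
  \sum_(w : patrol e T) random_oscillation R a b w * f (walk w)
    = (\sum_s f (oscillation a b s)) / T%:R.
Proof.
move=> eab eba; rewrite mulr_suml.
pose osc s := Patrol (oscillation_patrol s eab eba).
(* Pause times are grouped by the patrol they produce; [random_oscillation] counts each group. *)
rewrite (partition_big osc predT) //=; apply: eq_bigr => w _.
rewrite /random_oscillation -sum1_card natr_sum -mulrA mulr_suml.
rewrite [LHS](eq_bigl (fun s => osc s == w)) => [|s]; last first.
  by rewrite inE eq_sym.
by apply: eq_bigr => s /eqP <-; rewrite mul1r mulrC.
Qed.

Lemma random_oscillation_intercepts (R : realType) (c : N) (t : 'I_T) :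
    a != b -> e a b -> e b a ->
  \sum_(w : patrol e T) random_oscillation R a b w * (intercepts w (c, t))%:R
    = (c == a)%:R + (c == b)%:R * (1 - T%:R^-1).
Proof.
move=> ab eab eba.
rewrite (sum_random_oscillation
  (fun w => ((w t == c) || (w (ordS t) == c))%:R)) //.
under eq_bigr do rewrite oscillation_visits //.
have T0 : T%:R != 0 :> R by rewrite pnatr_eq0; case: (T) oddT.
have [->|ca] := eqVneq c a.
  by rewrite (negPf ab) /= sumr_const card_ord mul0r addr0 divff.
have [_|cb] := eqVneq c b; last by rewrite /= sumr_const mul0rn !mul0r addr0.
rewrite (bigD1 t) //= eqxx !add0r mul1r.
rewrite (eq_bigr (fun=> 1)) => [|s]; last by rewrite eq_sym => ->.
rewrite sumr_const cardC1 card_ord -subn1 natrB; last by case: (T) oddT.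
by rewrite mulrBl divff // mul1r.
Qed.

End Oscillation.

(** * Interception probabilities of biased oscillations *)

Section BiasedOscillation.
Variables (R : realType) (n T : nat) (oddT : odd T) (i j : 'I_n).
Hypothesis adj_ij : j = i.+1 :> nat.

Lemma right_biased_mixed (p : R) : 0 <= p <= 1 -> mixed (right_biased R n T p i j).
Proof.
move=> /andP[p0 p1].
have eij : line_graph n i j by rewrite /line_graph /= adj_ij eqxx.
have eji : line_graph n j i by rewrite /line_graph /= adj_ij eqxx orbT.
have mass (a b : 'I_n) : line_graph n a b -> line_graph n b a ->
    \sum_(w : patrol (line_graph n) T) random_oscillation R a b w = 1.
  move=> eab eba; under eq_bigr do rewrite -[random_oscillation _ _ _ _]mulr1.
  rewrite (sum_random_oscillation oddT (fun=> 1)) // sumr_const card_ord divff //.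
  by rewrite pnatr_eq0; case: (T) oddT.
split=> [w|].
  by rewrite ffunE addr_ge0 // mulr_ge0 ?subr_ge0 // divr_ge0.
under eq_bigr do rewrite ffunE.
by rewrite big_split /= -!mulr_sumr !mass // !mulr1 subrKC.
Qed.

Lemma right_biased_intercepts (p : R) (c : 'I_n) (t : 'I_T) :
  \sum_w right_biased R n T p i j w * (intercepts w (c, t))%:R
    = (c == i)%:R * (1 - p / T%:R) + (c == j)%:R * (1 - (1 - p) / T%:R).
Proof.
have eij : line_graph n i j by rewrite /line_graph /= adj_ij eqxx.
have eji : line_graph n j i by rewrite /line_graph /= adj_ij eqxx orbT.
have ij : i != j by rewrite -(inj_eq val_inj) /= adj_ij ltn_eqF.
under eq_bigr do rewrite ffunE mulrDl -(mulrA p) -(mulrA (1 - p)).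
rewrite big_split /= -!mulr_sumr !random_oscillation_intercepts // 1?eq_sym //.
by ring.
Qed.

End BiasedOscillation.

(** * The cover sequence and the resulting weight and bias of each edge *)

Section EqualizingStrategy.
Variables (R : realType) (T : nat) (hT : (2 <= T)%N).

(** The alternating tail of ones and zeros comes from the cap [minn] at odd [e] and from truncated
    subtraction at even [e]. *)
Definition cover (e : nat) : R :=
  if odd e then (minn e./2.+1 T)%:R / T%:R
  else (T.-1 - e./2)%:R / T.-1%:R.

Let T0 : T%:R != 0 :> R.
Proof. by rewrite pnatr_eq0 -lt0n; lia. Qed.

Let T10 : T.-1%:R != 0 :> R.
Proof. by rewrite pnatr_eq0 -lt0n; lia. Qed.

Lemma cover0 : cover 0 = 1.
Proof. by rewrite /cover /= subn0 divff. Qed.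

Lemma cover_end e : ~~ odd e -> (2 * T <= e.+2)%N -> cover e = 0.
Proof.
move=> /negPf eve eT; rewrite /cover eve (_ : _ - _ = 0)%N ?mul0r //.
by lia.
Qed.

Lemma cover_ge0 e : 0 <= cover e.
Proof. by rewrite /cover; case: odd; rewrite divr_ge0. Qed.

Lemma cover_succ e : 1 - cover e.+1 =
  if odd e then (minn e./2.+1 T.-1)%:R / T.-1%:R else (T.-1 - e./2)%:R / T%:R.
Proof.
rewrite /cover /= uphalf_half; case: (odd e) => /=.
  rewrite -{1}(divff T10) -mulrBl -natrB ?leq_subr //.
  by congr (_%:R / _); lia.
rewrite -{1}(divff T0) -mulrBl -natrB ?geq_minr //.
by congr (_%:R / _); lia.
Qed.

Lemma cover_compl_ge0 e : 0 <= 1 - cover e.+1.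
Proof. by rewrite cover_succ; case: odd; rewrite divr_ge0. Qed.

(** The ratio of the two fractions on an edge is one that some bias in [[0, 1]] achieves; [bias_itv]
    rests on this. *)
Lemma cover_ratio e :
  T.-1%:R * cover e <= T%:R * (1 - cover e.+1) /\
  T.-1%:R * (1 - cover e.+1) <= T%:R * cover e.
Proof.
have le_mul (z : R) : 0 <= z -> T.-1%:R * z <= T%:R * z.
  by move=> z0; rewrite ler_wpM2r // ler_nat leq_pred.
have x0 := cover_ge0 e; have y0 := cover_compl_ge0 e.
(* Even edges lie at one extreme of the allowed ratios, odd edges at the other until both their
   fractions equal 1. *)
suff [xy|[yx|xy]] : T.-1%:R * cover e = T%:R * (1 - cover e.+1) \/
    T.-1%:R * (1 - cover e.+1) = T%:R * cover e \/ cover e = 1 - cover e.+1.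
- by rewrite xy; split=> //; apply: le_trans (le_mul _ y0) _; rewrite -xy le_mul.
- by rewrite yx; split=> //; apply: le_trans (le_mul _ x0) _; rewrite -yx le_mul.
- by rewrite -xy le_mul.
rewrite cover_succ /cover; case: odd; [right|left]; last first.
  by rewrite ![_ * (_ / _)]mulrC !divfK.
have [ltT|geT] := ltnP e./2.+1 T; [left|right].
  rewrite ![_ * (_ / _)]mulrC !divfK //.
  by congr _%:R; lia.
by rewrite (minn_idPr _) ?divff //; lia.
Qed.

Definition edge_weight (e : nat) : R := cover e + (1 - cover e.+1).

(* When both ends get no cover this is [0 / 0 = 0]. *)
Definition bias (e : nat) : R :=
  (T%:R * (1 - cover e.+1) - T.-1%:R * cover e) / edge_weight e.

Lemma edge_weight_ge0 e : 0 <= edge_weight e.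
Proof. by rewrite addr_ge0 ?cover_ge0 ?cover_compl_ge0. Qed.

(** Clears the denominator of [bias]. This survives a zero weight, since its two nonnegative
    summands then vanish. *)
Lemma edge_weight_bias e :
  bias e * edge_weight e = T%:R * (1 - cover e.+1) - T.-1%:R * cover e.
Proof.
have [w0|w0] := eqVneq (edge_weight e) 0; last by rewrite divfK.
have /andP[/eqP -> /eqP ->] : (cover e == 0) && (1 - cover e.+1 == 0).
  by rewrite -paddr_eq0 ?cover_ge0 ?cover_compl_ge0 //; apply/eqP.
by rewrite w0 !mulr0 subrr.
Qed.

Lemma bias_itv e : 0 <= bias e <= 1.
Proof.
have [w0|w0] := eqVneq (edge_weight e) 0.
  by rewrite /bias w0 invr0 mulr0 lexx ler01.
have wp : 0 < edge_weight e by rewrite lt0r w0 edge_weight_ge0.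
have [le1 le2] := cover_ratio e.
rewrite -(pmulr_lge0 _ wp) -[X in _ && X](ler_pM2r wp) edge_weight_bias mul1r.
rewrite subr_ge0 le1 /= /edge_weight.
have : T%:R = T.-1%:R + 1 :> R by rewrite natr1 prednK //; lia.
by move=> T1; move: le2; rewrite T1; lra.
Qed.

Lemma sum_edge_weight m : \sum_(e < m) edge_weight e = m%:R + 1 - cover m.
Proof.
elim: m => [|m IH]; first by rewrite big_ord0 cover0; lra.
by rewrite big_ord_recr IH /edge_weight /= -natr1; lra.
Qed.

(** A node receives [cover c] from the edge on its right and [1 - cover c] from the one on its left,
    and node 0 has [cover 0 = 1]. The extra term stands for the missing edge to the right of [m]. *)
Lemma sum_cover_at (c m : nat) :
  \sum_(e < m) ((c == e :> nat)%:R * cover e + (c == e.+1)%:R * (1 - cover e.+1))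
    + (c == m)%:R * cover m = (c <= m)%N%:R :> R.
Proof.
elim: m => [|m IH].
  by rewrite big_ord0 cover0 mulr1 add0r leqn0.
rewrite big_ord_recr /= addrA IH [(c <= m.+1)%N]leq_eqVlt ltnS.
have [->|_] := eqVneq c m.+1; first by rewrite ltnn /=; lra.
by rewrite /=; lra.
Qed.

(** * The equalizing patrol on a line with [n] edges, hence [n.+1] nodes *)

Variables (n : nat) (oddT : odd T) (even_n : ~~ odd n) (hTn : (2 * T <= n.+2)%N).

Definition edge_left (e : 'I_n) : 'I_n.+1 := widen_ord (leqnSn n) e.
Definition edge_right (e : 'I_n) : 'I_n.+1 := lift ord0 e.

Definition edge_law : {ffun 'I_n -> R} := [ffun e : 'I_n => edge_weight e / n.+1%:R].

Definition edge_oscillation (e : 'I_n) : {ffun patrol (line_graph n.+1) T -> R} :=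
  right_biased R n.+1 T (bias e) (edge_left e) (edge_right e).

Definition equalizing_patrol : {ffun patrol (line_graph n.+1) T -> R} :=
  [ffun w => \sum_e edge_law e * edge_oscillation e w].

Lemma edge_law_mixed : mixed edge_law.
Proof.
split=> [e|]; first by rewrite ffunE divr_ge0 ?edge_weight_ge0.
under eq_bigr do rewrite ffunE.
(* The weights add up to exactly [n.+1] because [cover n = 0]. *)
rewrite -mulr_suml sum_edge_weight cover_end // subr0 natr1 divff //.
by rewrite pnatr_eq0.
Qed.

Lemma edge_oscillation_biased e : biased_oscillation (edge_oscillation e).
Proof.
by exists (bias e), (edge_left e), (edge_right e); split; rewrite ?bias_itv //; left.
Qed.

Lemma equalizing_patrol_mixture :
  mixture_of (@biased_oscillation R n.+1 T) equalizing_patrol.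
Proof.
exists n, edge_law, edge_oscillation; split.
- exact: edge_law_mixed.
- exact: edge_oscillation_biased.
- by move=> w; rewrite ffunE.
Qed.

Lemma equalizing_patrol_mixed : mixed equalizing_patrol.
Proof.
have osc e : mixed (edge_oscillation e).
  by apply: right_biased_mixed; rewrite ?bias_itv.
have [l0 l1] := edge_law_mixed.
split=> [w|].
  by rewrite ffunE; apply: sumr_ge0 => e _; rewrite mulr_ge0 // (osc e).1.
under eq_bigr do rewrite ffunE.
rewrite exchange_big -[RHS]l1; apply: eq_bigr => e _.
by rewrite -mulr_sumr (osc e).2 mulr1.
Qed.

(** Edge [e] contributes [v * cover e] at its left end and [v * (1 - cover e.+1)] at its right end;
    at every node these add up to [v], as [cover n = 0] leaves no boundary term. *)
Lemma equalizing_patrol_intercepts a :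
  \sum_w equalizing_patrol w * patrolling_game R 'I_n.+1 (line_graph n.+1) T w a
    = (2 * T%:R - 1) / (n.+1%:R * T%:R).
Proof.
case: a => c t.
under eq_bigr do rewrite ffunE mulr_suml.
rewrite exchange_big /=.
have n0 : n.+1%:R != 0 :> R by rewrite pnatr_eq0.
set v := _ / _.
transitivity (\sum_(e < n) v * ((c == e :> nat)%:R * cover e
                                + (c == e.+1 :> nat)%:R * (1 - cover e.+1))).
  apply: eq_bigr => e _; under eq_bigr do rewrite -mulrA.
  rewrite -mulr_sumr right_biased_intercepts // ffunE -!(inj_eq val_inj) /=.
  have T1 : T.-1%:R = T%:R - 1 :> R by rewrite -subn1 natrB //; lia.
  (* [bias e] is defined so as to solve this equation; [wR] is the counterpart at the right end. *)
  have wL : edge_weight e * (1 - bias e / T%:R) = (2 * T%:R - 1) / T%:R * cover e.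
    rewrite mulrBr mulr1 mulrCA mulrA edge_weight_bias T1 /edge_weight.
    by field.
  have wR : edge_weight e * (1 - (1 - bias e) / T%:R)
      = (2 * T%:R - 1) / T%:R * (1 - cover e.+1).
    transitivity (edge_weight e - edge_weight e / T%:R
                  + bias e * edge_weight e / T%:R); first by field.
    by rewrite edge_weight_bias T1 /edge_weight; field.
  transitivity (n.+1%:R^-1 *
      ((c == e :> nat)%:R * (edge_weight e * (1 - bias e / T%:R))
       + (c == e.+1 :> nat)%:R * (edge_weight e * (1 - (1 - bias e) / T%:R)))).
    by rewrite mulrDr; ring.
  by rewrite wL wR /v invfM; ring.
rewrite -mulr_sumr; have := sum_cover_at c n.
by rewrite (cover_end even_n hTn) mulr0 addr0 -ltnS ltn_ord => ->; rewrite mulr1.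
Qed.

End EqualizingStrategy.

(** * Value and optimal strategies of the patrolling game *)

Theorem proposition9 (R : realType) (n T : nat)
    (hT : (2 <= T)%N) (hn : (2 <= n)%N) (oddT : odd T) (oddn : odd n)
    (hTn : (2 * T <= n + 1)%N) :
  let G := patrolling_game R 'I_n (line_graph n) T in
  [/\ is_value G ((2 * T%:R - 1) / (n%:R * T%:R)),
      min_optimal G (uniform_attack R 'I_n T) &
      exists x, max_optimal G x /\ mixture_of (@biased_oscillation R n T) x].
Proof.
(* From here [n] is the number of edges, which is even. *)
case: n hn oddn hTn => [//|n] _ even_n; rewrite addn1 => hTn G.
have T_gt0 := ltnW hT.
have [] := @saddle_point R _ _ G (equalizing_patrol R T n)
  (uniform_attack R 'I_n.+1 T) ((2 * T%:R - 1) / (n.+1%:R * T%:R)).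
- exact: equalizing_patrol_mixed.
- exact: uniform_attack_mixed.
- by move=> a; rewrite equalizing_patrol_intercepts.
- by move=> w; exact: uniform_attack_payoff_le.
move=> value_G max_x min_y; split=> //.
by exists (equalizing_patrol R T n); split=> //; exact: equalizing_patrol_mixture.
Qed.
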